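(* There is a positive constant $c$ such that for all integers $n\ge 20$, $$ D(n)<1-\frac{c}{(\log\log n)^{1-\frac{1}{2}{\rm e}\log 2}\sqrt{\log\log\log n}}. $$
   Context: For a positive integer $n$, a set $S\subseteq \mathbb{Z}/n\mathbb{Z}$ is called product-free if there are no $a,b,c\in S$ (not necessarily distinct) with $ab\equiv c \pmod n$. For such $S$ let $D(S)=|S|/n$, and let $D(n)$ denote the maximum of $D(S)$ over all product-free sets $S\subseteq\mathbb{Z}/n\mathbb{Z}$. Here $\log$ is the natural logarithm and ${\rm e}$ is Euler's number. *)

(* Defs.v *)
From mathcomp Require Import all_boot all_order all_algebra.
From mathcomp Require Import all_classical all_reals all_analysis.

Set Implicit Arguments.
Unset Strict Implicit.
Unset Printing Implicit Defensive.

Import Order.TTheory GRing.Theory Num.Theory.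
Local Open Scope ring_scope.

(* Z/nZ is represented by its residues 'I_n, which, unlike 'Z_n, has exactly
   n elements for every n > 0. *)
Definition product_free (n : nat) (S : {set 'I_n}) : bool :=
  [forall a in S, forall b in S, forall c in S, (a * b != c %[mod n])%N].

Definition density (R : realType) (n : nat) (S : {set 'I_n}) : R :=
  #|S|%:R / n%:R.

(* The default value 0 does not affect the maximum: it is the density of the
   empty set, which is product-free. *)
Definition max_density (R : realType) (n : nat) : R :=
  \big[Num.max/0]_(S : {set 'I_n} | product_free S) density R S.

(* Main.v *)
Require Import Defs.
From mathcomp Require Import all_boot all_order all_algebra.
From mathcomp Require Import all_classical all_reals all_analysis.
From mathcomp Require Import zify ring lra.
(* restores the finite-set names shadowed by [classical_sets] *)
From mathcomp Require Import fintype finset.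

Set Implicit Arguments.
Unset Strict Implicit.
Unset Printing Implicit Defensive.

Import Order.TTheory GRing.Theory Num.Theory.
Local Open Scope ring_scope.

(* Let T be the complement of a product-free set S modulo n, U the group of
   units, and for a set D of prime divisors of n let d be its product. The
   map u |-> d u from U to the residues of gcd d with n has fibres of size at
   most d, so if at least half of the products d u lie outside S ("D is bad")
   then T contains at least |U| / (2 d) residues of gcd d. If D and D' are
   disjoint and not bad, some d u0 lies in S, and S being product-free then
   forces the union of D and D' to be bad. Fix k. Either a positive
   proportion (for the weight 1/d) of the k-subsets are bad, or a random
   2k-subset splits with positive probability into two k-subsets that are not
   bad, and then it is itself bad. Either way |T| is at least a constant
   times |U| min(e_k, e_2k), where e_j is the j-th elementary symmetric
   function of the 1/p, p | n. If lam is the sum of the 1/p, then e_j is of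
   order lam^j / j! for j <= 3/2 lam and |U| / n is at least exp (- lam - 1).
   The choice k ~ (e/4) lam and Stirling's formula then bound |T| / n below
   by a constant times exp (- (1 - (e/2) log 2) lam) / sqrt lam, and lam is
   at most log log log n + O(1) by Mertens' theorem. *)

(** * Elementary symmetric functions *)

Section ElementarySymmetric.
Variables (R : realFieldType) (I : finType) (y : I -> R).
Hypothesis y_ge0 : forall i, 0 <= y i.

Definition setweight (D : {set I}) : R := \prod_(i in D) y i.

Definition elemsym (k : nat) : R := \sum_(D : {set I} | #|D| == k) setweight D.

Lemma setweight_ge0 D : 0 <= setweight D.
Proof. exact: prodr_ge0. Qed.

Lemma elemsym_ge0 k : 0 <= elemsym k.
Proof. by apply: sumr_ge0 => D _; exact: setweight_ge0. Qed.

Lemma elemsym0 : elemsym 0 = 1.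
Proof.
rewrite /elemsym (big_pred1 set0) => [|D]; last by rewrite cards_eq0.
by rewrite /setweight big_set0.
Qed.

Lemma setweightU1 i (D : {set I}) :
  i \notin D -> setweight (i |: D) = y i * setweight D.
Proof. by move=> iD; rewrite /setweight big_setU1. Qed.

Lemma setweightU (D E : {set I}) : [disjoint D & E] ->
  setweight (D :|: E) = setweight D * setweight E.
Proof.
move=> DE; rewrite /setweight -bigU //=.
by apply: eq_bigl => i; rewrite inE.
Qed.

(** Double counting: a set [E] with a marked element [i] amounts to the set [D = E :\ i] with a
    marked element outside it. *)
Lemma sum_setD1 k (F : {set I} -> I -> R) :
  \sum_(E : {set I} | #|E| == k.+1) \sum_(i in E) F (E :\ i) i =
  \sum_(D : {set I} | #|D| == k) \sum_(i in ~: D) F D i.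
Proof.
rewrite (exchange_big_dep xpredT) //= [RHS](exchange_big_dep xpredT) //=.
apply: eq_bigr => i _.
rewrite (reindex_onto (fun D => i |: D) (fun E => E :\ i)) /=; last first.
  by move=> E /andP[_ iE]; rewrite setD1K.
apply: eq_big => [D|D /andP[_ /eqP ->] //].
rewrite !inE eqxx /= andbT cardsU1.
case: (boolP (i \in D)) => iD /=.
  rewrite andbF; apply/negbTE; rewrite negb_and.
  apply/orP; right; apply: contraTneq iD => <-; by rewrite !inE eqxx.
by rewrite andbT add1n eqSS setU1K // eqxx andbT.
Qed.

Lemma elemsymS k : k.+1%:R * elemsym k.+1 =
  \sum_(D : {set I} | #|D| == k) \sum_(i in ~: D) setweight D * y i.
Proof.
rewrite -(sum_setD1 k (fun D i => setweight D * y i)) /elemsym big_distrr /=.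
apply: eq_bigr => E /eqP cE.
rewrite (eq_bigr (fun=> setweight E)) => [|i iE]; last first.
  by rewrite mulrC -setweightU1 ?setD1K // !inE eqxx.
by rewrite sumr_const cE mulr_natl.
Qed.

Lemma elemsym_sumM k : (\sum_i y i) * elemsym k =
  \sum_(D : {set I} | #|D| == k) \sum_(i in ~: D) setweight D * y i +
  \sum_(D : {set I} | #|D| == k) \sum_(i in D) setweight D * y i.
Proof.
rewrite -big_split /= /elemsym big_distrr /=; apply: eq_bigr => D _.
rewrite mulrC big_distrr /= (bigID (fun i => i \in D)) /= addrC.
by congr (_ + _); apply: eq_bigl => i; rewrite inE.
Qed.

Lemma elemsymS_le k : k.+1%:R * elemsym k.+1 <= (\sum_i y i) * elemsym k.
Proof.
rewrite elemsymS elemsym_sumM lerDl; apply: sumr_ge0 => D _; apply: sumr_ge0 => i _.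
by rewrite mulr_ge0 // setweight_ge0.
Qed.

(** When [elemsym k.+1] is multiplied by the sum of the [y i], the terms with [i] in [D] are
    [setweight (D :\ i) * y i ^+ 2]. Letting [i] range over all of [I], and not only outside
    [D :\ i], bounds their total by the sum of squares times [elemsym k]. *)
Lemma elemsymSS_ge k :
  (\sum_i y i) * elemsym k.+1 - (\sum_i y i ^+ 2) * elemsym k <=
  k.+2%:R * elemsym k.+2.
Proof.
rewrite elemsymS elemsym_sumM lerBlDr lerD2l.
rewrite (eq_bigr (fun D : {set I} =>
  \sum_(i in D) setweight (D :\ i) * y i ^+ 2)); last first.
  move=> D _; apply: eq_bigr => i iD.
  by rewrite -{1}(setD1K iD) setweightU1 ?inE ?eqxx //; ring.
rewrite (sum_setD1 k (fun D i => setweight D * y i ^+ 2)).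
rewrite mulrC /elemsym big_distrl /=; apply: ler_sum => D _.
rewrite big_distrr /= [leRHS](bigID (fun i => i \in ~: D)) /= lerDl.
by apply: sumr_ge0 => i _; rewrite mulr_ge0 ?setweight_ge0 // exprn_ge0.
Qed.

Lemma elemsym1 : elemsym 1 = \sum_i y i.
Proof.
have := elemsymS 0; rewrite mul1r => ->.
rewrite (big_pred1 set0) => [|D]; last by rewrite cards_eq0.
rewrite (eq_bigl xpredT) => [|i]; last by rewrite !inE.
by apply: eq_bigr => i _; rewrite /setweight big_set0 mul1r.
Qed.

(** Halvings of [k.*2]-sets correspond to ordered pairs of disjoint [k]-sets. *)
Lemma sum_setD k (F : {set I} -> {set I} -> R) :
  \sum_(E : {set I} | #|E| == k.*2)
     \sum_(D : {set I} | (D \subset E) && (#|D| == k)) F D (E :\: D) =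
  \sum_(D : {set I} | #|D| == k)
     \sum_(D' : {set I} | (#|D'| == k) && [disjoint D & D']) F D D'.
Proof.
rewrite (exchange_big_dep (fun D : {set I} => #|D| == k)) /=; last first.
  by move=> E D _ /andP[].
apply: eq_bigr => D /eqP cD.
rewrite (reindex_onto (fun D' => D :|: D') (fun E => E :\: D)) /=; last first.
  move=> E /andP[_ /andP[DE _]].
  by rewrite setUC setDE setUIl (setUC (~: D)) setUCr setIT; apply/setUidPl.
have UD D' : ((D :|: D') :\: D == D') = [disjoint D & D'].
  by rewrite setDUl setDv set0U disjoint_sym; apply/eqP/setDidPl.
apply: eq_big => [D'|D' /andP[_ /eqP -> //]].
rewrite UD subsetUl cD eqxx andbT /=; case: (boolP [disjoint D & D']) => dis.
  by rewrite cardsU disjoint_setI0 // cards0 subn0 cD -addnn eqn_add2l !andbT.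
by rewrite !andbF.
Qed.

(* Markov's inequality for a uniformly random halving of E: each half is
   distributed almost as a random k-set. *)
Lemma elemsym_split_bad k (B : pred {set I}) :
  'C(k.*2, k)%:R *
    (\sum_(E : {set I} | (#|E| == k.*2) &&
      ~~ [exists D : {set I}, [&& D \subset E, #|D| == k, ~~ B D & ~~ B (E :\: D)]])
      setweight E)
  <= 2 * (\sum_(D : {set I} | (#|D| == k) && B D) setweight D) * elemsym k.
Proof.
pose b D : R := (B D)%:R.
have b_ge0 D : 0 <= b D by rewrite ler0n.
have step1 : 'C(k.*2, k)%:R *
    (\sum_(E : {set I} | (#|E| == k.*2) &&
      ~~ [exists D : {set I}, [&& D \subset E, #|D| == k, ~~ B D & ~~ B (E :\: D)]])
      setweight E) <=
   \sum_(E : {set I} | #|E| == k.*2)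
     \sum_(D : {set I} | (D \subset E) && (#|D| == k))
       (b D + b (E :\: D)) * (setweight D * setweight (E :\: D)).
  rewrite [leRHS](bigID (fun E : {set I} => ~~ [exists D : {set I},
    [&& D \subset E, #|D| == k, ~~ B D & ~~ B (E :\: D)]])) /=.
  rewrite big_distrr /= -[leLHS]addr0; apply: lerD; last first.
    apply: sumr_ge0 => E _; apply: sumr_ge0 => D _.
    by rewrite mulr_ge0 ?addr_ge0 // mulr_ge0 // setweight_ge0.
  (* [E] has ['C(k.*2, k)] halvings, and each contributes at least [setweight E] because one of its
     halves satisfies [B]. *)
  apply: ler_sum => E /andP[/eqP cE /existsPn nE].
  rewrite -cE -cards_draws -sum1_card natr_sum big_distrl /=.
  rewrite (eq_bigl (fun D : {set I} => (D \subset E) && (#|D| == k))) => [|D];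
    last by rewrite inE.
  apply: ler_sum => D /andP[DE cD].
  rewrite -setweightU; last by rewrite disjoint_sym disjoints_subset subsetDr.
  have -> : D :|: E :\: D = E by rewrite -{1}(setIidPr DE) setID.
  rewrite ler_wpM2r ?setweight_ge0 // -natrD ler_nat.
  by have := nE D; rewrite DE cD /=; case: (B D); case: (B _).
apply: (le_trans step1).
rewrite (sum_setD k (fun D D' => (b D + b D') * (setweight D * setweight D'))).
have step2 : \sum_(D : {set I} | #|D| == k)
     \sum_(D' : {set I} | (#|D'| == k) && [disjoint D & D'])
        (b D + b D') * (setweight D * setweight D') <=
  \sum_(D : {set I} | #|D| == k)
     \sum_(D' : {set I} | #|D'| == k) (b D + b D') * (setweight D * setweight D').
  apply: ler_sum => D _.
  rewrite [leRHS](bigID (fun D' : {set I} => [disjoint D & D'])) /= lerDl.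
  apply: sumr_ge0 => D' _.
  by rewrite mulr_ge0 ?addr_ge0 // mulr_ge0 // setweight_ge0.
apply: (le_trans step2).
have -> : \sum_(D : {set I} | (#|D| == k) && B D) setweight D =
   \sum_(D : {set I} | #|D| == k) b D * setweight D.
  rewrite big_mkcondr; apply: eq_bigr => D _; rewrite /b.
  by case: (B D); rewrite ?mul1r ?mul0r.
set W := \sum_(D | _) _ * _.
rewrite (eq_bigr (fun D =>
  b D * setweight D * elemsym k + setweight D * W)); last first.
  move=> D _; rewrite /W /elemsym !big_distrr -big_split /=.
  by apply: eq_bigr => D' _; ring.
rewrite big_split /= -!big_distrl /= -/W -/(elemsym k).
by rewrite le_eqVlt; apply/orP; left; apply/eqP; ring.
Qed.

End ElementarySymmetric.

(** * Comparison of elementary symmetric functions with lam^k / k! *)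

Section EsymEstimates.
Variables (R : realType) (I : finType) (y : I -> R).
Hypothesis y_ge0 : forall i, 0 <= y i.
Let lam := \sum_i y i.

Lemma elemsym_le k : elemsym y k <= lam ^+ k / k`!%:R.
Proof.
have lam0 : 0 <= lam by exact: sumr_ge0.
elim: k => [|k IH]; first by rewrite elemsym0 fact0 divr1.
have k0 : (0 : R) < k.+1%:R by rewrite ltr0n.
rewrite -(ler_pM2l k0); apply: le_trans (elemsymS_le y_ge0 k) _.
apply: le_trans (ler_wpM2l lam0 IH) _.
rewrite le_eqVlt; apply/orP; left; apply/eqP.
rewrite exprS factS natrM; field.
by rewrite nat1r !pnatr_eq0 -?lt0n ?fact_gt0.
Qed.

Hypothesis y_sqr : \sum_i y i ^+ 2 <= 1.

Lemma elemsymS_ge k : 12 <= lam -> k.+1%:R <= 3 / 2 * lam ->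
  (lam - 3) * elemsym y k <= k.+1%:R * elemsym y k.+1.
Proof.
move=> l12; elim: k => [|k IH] kl; first by rewrite elemsym0 elemsym1 -/lam; lra.
have kl' : k.+1%:R <= 3 / 2 * lam.
  by apply: le_trans kl; rewrite ler_nat.
have {}IH := IH kl'.
have H := elemsymSS_ge y_ge0 k; apply: le_trans H; rewrite -/lam.
have e0 := elemsym_ge0 y_ge0 k; have e1 := elemsym_ge0 y_ge0 k.+1.
have H1 : (\sum_i y i ^+ 2) * elemsym y k <= elemsym y k.
  by rewrite -[leRHS]mul1r ler_wpM2r.
(* The induction hypothesis gives [elemsym y k <= 3 * elemsym y k.+1], since 3/2 lam <= 3 (lam - 3)
   for lam >= 6. This is the 3 subtracted in the statement. *)
have H2 : (lam - 3) * elemsym y k <= (lam - 3) * (3 * elemsym y k.+1).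
  apply: le_trans IH _.
  apply: le_trans (ler_wpM2r e1 kl') _.
  have : 0 <= (lam - 6) * elemsym y k.+1 by rewrite mulr_ge0 //; lra.
  lra.
rewrite ler_pM2l in H2; last lra.
lra.
Qed.

(** Iterating the ratio bound loses the factor (1 - 3 / lam)^k. As 1 - 3 / lam >= exp (- 6 / lam)
    and k <= 3/2 lam, at least exp (- 9) remains. *)
Lemma elemsym_ge k : 12 <= lam -> k%:R <= 3 / 2 * lam ->
  expR (- 9) * (lam ^+ k / k`!%:R) <= elemsym y k.
Proof.
move=> l12 kl.
have l0 : 0 < lam by lra.
have step : (lam - 3) ^+ k / k`!%:R <= elemsym y k.
  elim: k kl => [|k IH] kl; first by rewrite elemsym0 fact0 divr1.
  have kl' : k%:R <= 3 / 2 * lam.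
    by apply: le_trans kl; rewrite ler_nat.
  have k0 : (0 : R) < k.+1%:R by rewrite ltr0n.
  rewrite -(ler_pM2l k0); apply: le_trans (elemsymS_ge l12 kl).
  have l3 : 0 <= lam - 3 by lra.
  apply: le_trans (ler_wpM2l l3 (IH kl')).
  rewrite le_eqVlt; apply/orP; left; apply/eqP.
  rewrite exprS factS natrM; field.
  by rewrite nat1r !pnatr_eq0 -?lt0n ?fact_gt0.
apply: le_trans step; rewrite mulrA ler_wpM2r ?invr_ge0 ?ler0n //.
have base : expR (- (6 / lam)) * lam <= lam - 3.
  rewrite expRN mulrC ler_pdivrMr ?expR_gt0 //.
  have := expR_ge1Dx (6 / lam) => H.
  have l3 : 0 <= lam - 3 by lra.
  apply: le_trans (ler_wpM2l l3 H).
  have -> : (lam - 3) * (1 + 6 / lam) = lam + 3 - 18 / lam by field; rewrite gt_eqF.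
  have : 18 / lam <= 3 by rewrite ler_pdivrMr //; lra.
  lra.
apply: le_trans (_ : (expR (- (6 / lam)) * lam) ^+ k <= _); last first.
  by apply: lerXn2r => //; rewrite nnegrE ?mulr_ge0 ?expR_ge0 //; lra.
rewrite exprMn ler_wpM2r ?exprn_ge0 //; first lra.
rewrite -expRM_natl ler_expR mulrN lerN2 mulrA ler_pdivrMr //; lra.
Qed.

End EsymEstimates.

(** * Estimates for the logarithm and for Poisson weights *)

Section RealEstimates.
Variable R : realType.
Implicit Types x s t lam : R.

(** The function f(t) = ln t + 4 / (1 + t) has derivative (t - 1)^2 / (t (1 + t)^2), so f(1) <= f(1
    + x). This precision is what yields the factor sqrt k in Stirling's bound. *)
Lemma ln_ge_pade x : 0 <= x -> 2 * x / (2 + x) <= ln (1 + x).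
Proof.
move=> x0; pose g t : R := 1 + t; pose f : R -> R := (@ln R) + 4 *: (fun t => (g t)^-1).
have fE t : f t = ln t + 4 * (1 + t)^-1 by [].
have df t : 0 < t -> is_derive t 1 f (t^-1 + 4 * (- (1 + t) ^- 2)).
  move=> t0; have t1 : 1 + t != 0 by lra.
  have D1 := is_derive1_ln t0.
  have D2 : is_derive t 1 g 1.
    by have := is_deriveD (is_derive_cst (1 : R) t 1) (is_derive_id t 1); rewrite add0r.
  have D3 : is_derive t 1 (fun u => (g u)^-1) (- (1 + t) ^- 2).
    by apply: is_derive_eq; rewrite /GRing.scale /= mulr1.
  exact: is_deriveD.
have mono : f 1 <= f (1 + x).
  apply: (@ger0_derive1_le_cc R f 1 (1 + x)).
  - move=> t; rewrite in_itv /= => /andP[t1 _].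
    have t0 : 0 < t by lra.
    by have [] := df _ t0.
  - move=> t; rewrite in_itv /= => /andP[t1 _].
    have t0 : 0 < t by lra.
    rewrite derive1E; have [_ ->] := df _ t0.
    have -> : t^-1 + 4 * - (1 + t) ^- 2 = (t - 1) ^+ 2 / (t * (1 + t) ^+ 2).
      by field; rewrite ?gt_eqF //; lra.
    by rewrite divr_ge0 ?sqr_ge0 // mulr_ge0 ?sqr_ge0 // ltW.
  - apply: derivable_within_continuous => t; rewrite in_itv /= => /andP[t1 _].
    have t0 : 0 < t by lra.
    by have [] := df _ t0.
  - by rewrite in_itv /=; apply/andP; split; lra.
  - by rewrite in_itv /=; apply/andP; split; lra.
  - lra.
move: mono; rewrite !fE ln1 add0r -lerBlDr => H; apply: le_trans H.
have -> // : 4 * (1 + 1)^-1 - 4 * (1 + (1 + x))^-1 = 2 * x / (2 + x).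
by field; rewrite ?gt_eqF //; lra.
Qed.

(** Stirling's bound k! <= e sqrt k (k / e)^k, by induction. The increment needs (k + 1/2) ln (1 +
    1/k) >= 1, which is the Pade bound at x = 1/k. *)
Lemma ln_fact_le (k : nat) : (0 < k)%N ->
  ln (k`!%:R : R) <= 1 + (k%:R + 2^-1) * ln k%:R - k%:R.
Proof.
case: k => // k _; elim: k => [|k IH].
  by rewrite (factS 0) fact0 ln1 mulr0 addr0 subrr.
have k0 : (0 : R) < k.+1%:R by rewrite ltr0n.
have k0' : (0 : R) < k.+2%:R by rewrite ltr0n.
rewrite factS natrM lnM ?posrE ?ltr0n ?fact_gt0 //.
have kE : k.+2%:R = k.+1%:R + 1 :> R by rewrite -natr1.
have step : 1 <= (k.+1%:R + 2^-1) * (ln k.+2%:R - ln k.+1%:R) :> R.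
  rewrite -ln_div ?posrE //.
  have -> : k.+2%:R / k.+1%:R = 1 + k.+1%:R^-1 :> R.
    by rewrite kE mulrDl divff ?gt_eqF // mul1r.
  apply: le_trans (ler_wpM2l _ (ln_ge_pade _)); last by rewrite invr_ge0 ltW.
    rewrite le_eqVlt; apply/orP; left; apply/eqP.
    by field; rewrite ?gt_eqF //=; lra.
  by rewrite addr_ge0 ?invr_ge0 // ltW.
move: IH step; rewrite kE; set a := ln _; set b := ln _; set c := ln _; lra.
Qed.

Lemma ln_ge1BV t : 0 < t -> 1 - t^-1 <= ln t.
Proof.
move=> t0; have := @le_ln1Dx R (t^-1 - 1).
rewrite (_ : 1 + (t^-1 - 1) = t^-1); last by ring.
rewrite lnV ?posrE // => H.
have : - 1 < t^-1 - 1 by rewrite ltrBrDr addNr invr_gt0.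
by move=> /H; lra.
Qed.

(** Compares (e lam / s)^s at a real s with the Poisson weight at an integer m just below it.
    Passing from s to m costs (lam / m)^(s - m) <= C0^2; Stirling's bound supplies the rest. *)
Lemma poisson_ln_ge lam s C0 (m : nat) : (0 < m)%N -> 0 < lam -> 1 <= C0 ->
  lam <= C0 * m%:R -> m%:R <= s <= m%:R + 2 ->
  s + s * (ln lam - ln s) <=
  2 * ln C0 + 1 + 2^-1 * ln m%:R + m%:R * ln lam - ln (m`!%:R).
Proof.
move=> m0 lam0 C1 lamC /andP[ms sm].
have m0' : (0 : R) < m%:R by rewrite ltr0n.
have s0 : 0 < s by lra.
have C0p : 0 < C0 by lra.
have H1 := ln_fact_le m0.
have H2 : s - m%:R <= s * (ln s - ln m%:R).
  rewrite -ln_div ?posrE //.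
  have /(ler_wpM2l (ltW s0)) := ln_ge1BV (divr_gt0 s0 m0').
  apply: le_trans; rewrite le_eqVlt; apply/orP; left; apply/eqP.
  by field; rewrite ?gt_eqF.
have H3 : ln lam <= ln C0 + ln m%:R.
  by rewrite -lnM ?posrE // ler_ln ?posrE // mulr_gt0.
have H4 : 0 <= ln C0 by apply: ln_ge0.
move: H1 H2 H3 H4; set a := ln (m`!)%:R; set b := ln m%:R; set c := ln s.
set d := ln lam; set f := ln C0; set M := m%:R in ms sm m0' *.
by move=> H1 H2 H3 H4; nra.
Qed.

Lemma expR1_le : expR 1 <= 14 / 5 :> R.
Proof.
(* Cutting the exponent into 32 parts makes 1 + x <= exp x sharp enough: (32/31)^32 < 14/5. *)
have -> : (1 : R) = 32%:R * 32^-1 by rewrite divff.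
rewrite expRM_natl.
have : expR (32^-1) <= 32 / 31 :> R.
  rewrite -[leLHS]invrK -expRN (_ : 32 / 31 = (31 / 32)^-1); last by field.
  rewrite lef_pV2 ?posrE ?expR_gt0 ?divr_gt0 //.
  apply: le_trans (expR_ge1Dx _); lra.
move/(lerXn2r 32); rewrite !nnegrE expR_ge0 => /(_ isT) H.
apply: le_trans (H _) _; lra.
Qed.

End RealEstimates.

(** * Chebyshev's and Mertens' bounds *)

Lemma dvdn_prod_primepow (s : seq nat) (e : nat -> nat) (M : nat) : uniq s ->
  (forall p, p \in s -> prime p) -> (forall p, p \in s -> p ^ e p %| M)%N ->
  (\prod_(p <- s) p ^ e p %| M)%N.
Proof.
elim: s => [|p s IH] /=; first by rewrite big_nil dvd1n.
move=> /andP[ps us] pr dv; rewrite big_cons Gauss_dvd.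
  rewrite dv ?mem_head // IH // => q qs.
    by apply: pr; rewrite inE qs orbT.
  by apply: dv; rewrite inE qs orbT.
apply: coprimeXl; rewrite prime_coprime ?pr ?mem_head //.
rewrite big_seq Euclid_dvd_prod ?pr ?mem_head // big_has_cond.
apply/negP => /hasP[q qs] /andP[_].
have pp := pr p (mem_head _ _).
have pq : prime q by apply: pr; rewrite inE qs orbT.
rewrite Euclid_dvdX // => /andP[]; rewrite dvdn_prime2 // => /eqP pE.
by rewrite pE qs in ps.
Qed.

Lemma prime_dvd_fact p m : prime p -> (p %| m`!)%N -> (p <= m)%N.
Proof.
move=> pp; elim: m => [|m IH]; first by rewrite fact0 Euclid_dvd1.
rewrite factS Euclid_dvdM // => /orP[/dvdn_leq -> //|/IH]; exact: leqW.
Qed.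

Lemma bin_le_exp2 n k : ('C(n, k) <= 2 ^ n)%N.
Proof.
elim: n k => [|n IH] [|k] //; first by rewrite bin0 expn_gt0.
by rewrite binS expnS mul2n -addnn leq_add.
Qed.

(** A prime in (m, 2m] divides (2m)! but not m!. *)
Lemma prod_primes_dvd_bin m :
  (\prod_(m.+1 <= p < m.*2.+1 | prime p) p %| 'C(m.*2, m))%N.
Proof.
rewrite -big_filter -[in X in (X %| _)%N](eq_bigr _ (fun p _ => expn1 p)).
apply: (dvdn_prod_primepow (e := fun=> 1%N)).
- by rewrite filter_uniq // iota_uniq.
- by move=> p; rewrite mem_filter => /andP[].
move=> p; rewrite mem_filter mem_index_iota expn1 => /and3P[pp mp pm].
have m2 : (m <= m.*2)%N by lia.
have : (p %| (m.*2)`!)%N by rewrite dvdn_fact // prime_gt0.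
rewrite -(bin_fact m2) !Euclid_dvdM // => /orP[//|].
have -> : (m.*2 - m = m)%N by lia.
by rewrite orbb => /(prime_dvd_fact pp); lia.
Qed.

(** Strong induction with m = ceil (N/2): the primes up to m contribute at most 16^m and those in
    (m, 2m] at most 4^m. The total 2^(6m) is at most 2^(4N) because 2m <= N + 1 and N >= 3. *)
Lemma primorial_le N : (\prod_(1 <= p < N.+1 | prime p) p <= 16 ^ N)%N.
Proof.
elim/ltn_ind: N => N IH.
have [|N3] := ltnP N 3.
  by case: N {IH} => [|[|[|]]] // _; rewrite unlock.
pose m := uphalf N.
have [Nm mN mN'] : [/\ (N <= m.*2)%N, (m < N)%N & (m.*2 <= N.+1)%N].
  by rewrite /m; split; lia.
apply: leq_trans (_ : \prod_(1 <= p < m.*2.+1 | prime p) p <= _)%N.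
  rewrite [leqRHS](big_cat_nat _ _ (n := N.+1)) //= leq_pmulr //.
  by rewrite prodn_cond_gt0 // => p; exact: prime_gt0.
rewrite (big_cat_nat _ _ (n := m.+1)) //=; last by lia.
have H1 := IH _ mN.
have H2 : (\prod_(m.+1 <= p < m.*2.+1 | prime p) p <= 2 ^ m.*2)%N.
  apply: leq_trans (bin_le_exp2 _ m).
  by rewrite dvdn_leq ?prod_primes_dvd_bin // bin_gt0; lia.
apply: leq_trans (leq_mul H1 H2) _.
rewrite (_ : 16 = 2 ^ 4)%N // -!expnM -expnD leq_exp2l //; lia.
Qed.

Section Mertens.
Variable R : realType.

Lemma ler_sum_sub_uniq (T : eqType) (s t : seq T) (F : T -> R) :
  uniq s -> uniq t -> {subset s <= t} -> (forall i, i \in t -> 0 <= F i) ->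
  \sum_(i <- s) F i <= \sum_(i <- t) F i.
Proof.
move=> us ut st F0; rewrite [leRHS](bigID (fun i => i \in s)) /=.
rewrite -[X in _ <= X + _]big_filter.
rewrite [X in _ <= X + _](perm_big s) /=; last first.
  apply: uniq_perm; rewrite ?filter_uniq // => i.
  by rewrite mem_filter andb_idr //; exact: st.
by rewrite lerDl big_seq_cond sumr_ge0 // => i /andP[/F0].
Qed.

(** [N %/ p] is the first term of Legendre's formula, so the product of the [p ^ (N %/ p)] divides
    N!, which is at most N^N. *)
Lemma sum_divn_ln_prime (N : nat) : (0 < N)%N ->
  \sum_(1 <= p < N.+1 | prime p) (N %/ p)%:R * ln p%:R <= N%:R * ln N%:R :> R.
Proof.
move=> N0.
have fact_le : (N`! <= N ^ N)%N.
  rewrite fact_prod -[X in (_ <= _ ^ X)%N](subn1 N.+1) -prod_nat_const_nat.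
  rewrite big_nat_cond [leqRHS]big_nat_cond; apply: leq_prod => i.
  by rewrite andbT ltnS => /andP[].
have prod_le : (\prod_(1 <= p < N.+1 | prime p) p ^ (N %/ p) <= N ^ N)%N.
  apply: leq_trans fact_le; apply: dvdn_leq; first exact: fact_gt0.
  rewrite -big_filter; apply: (@dvdn_prod_primepow _ (fun p => N %/ p)%N).
  - by rewrite filter_uniq // iota_uniq.
  - by move=> p; rewrite mem_filter => /andP[].
  move=> p; rewrite mem_filter => /andP[pp _].
  rewrite pfactor_dvdn ?fact_gt0 // logn_fact // big_ltn //.
  by rewrite expn1 leq_addr.
rewrite -ler_expR expR_sum expRM_natl lnK ?posrE ?ltr0n // -natrX.
apply: le_trans (_ : (\prod_(1 <= p < N.+1 | prime p) p ^ (N %/ p))%:R <= _);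
  last by rewrite ler_nat.
rewrite natr_prod le_eqVlt; apply/orP; left; apply/eqP.
apply: eq_bigr => p pp.
by rewrite expRM_natl lnK ?natrX // posrE ltr0n prime_gt0.
Qed.

Lemma chebyshev_theta_le (N : nat) :
  \sum_(1 <= p < N.+1 | prime p) ln p%:R <= N%:R * ln 16 :> R.
Proof.
rewrite -ler_expR expR_sum expRM_natl lnK ?posrE ?ltr0n //.
have := primorial_le N; rewrite -(ler_nat R) natrX; apply: le_trans.
rewrite natr_prod le_eqVlt; apply/orP; left; apply/eqP.
by apply: eq_bigr => p pp; rewrite lnK // posrE ltr0n prime_gt0.
Qed.

(** N / p exceeds [N %/ p] by less than 1, and Chebyshev's bound pays for this rounding. *)
Lemma mertens1_le (N : nat) : (0 < N)%N ->
  \sum_(1 <= p < N.+1 | prime p) ln p%:R / p%:R <= ln N%:R + ln 16 :> R.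
Proof.
move=> N0; have N0' : (0 : R) < N%:R by rewrite ltr0n.
rewrite -(ler_pM2l N0') mulrDr.
apply: le_trans (lerD (sum_divn_ln_prime N0) (chebyshev_theta_le N)).
rewrite -big_split /= big_distrr /=; apply: ler_sum => p pp.
have p0 : (0 < p)%N := prime_gt0 pp.
have lp : 0 <= ln p%:R :> R by rewrite ln_ge0 // ler1n.
have := ltn_ceil N p0; rewrite -(ltr_nat R) natrM -natr1 => /ltW H.
have p0' : (0 : R) < p%:R by rewrite ltr0n.
rewrite -[X in _ <= _ + X]mul1r -mulrDl mulrA mulrAC ler_wpM2r //.
by rewrite ler_pdivrMr.
Qed.

(* Abel summation of [mertens1_le], carried out by induction on [N]. *)
Lemma mertens2_aux (N : nat) : (2 <= N)%N ->
  \sum_(1 <= p < N.+1 | prime p) p%:R^-1 <=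
  (\sum_(1 <= p < N.+1 | prime p) ln p%:R / p%:R) / ln N%:R
  + ln (ln N%:R) - ln (ln 2) + ln 16 * ((ln 2)^-1 - (ln N%:R)^-1) :> R.
Proof.
case: N => [|[|N]] // _; elim: N => [|N IH].
  rewrite [leLHS]big_mkcond [X in X / _]big_mkcond !(@big_nat_recr _ _ _ 2) //=.
  rewrite !(@big_nat_recr _ _ _ 1) //= !big_geq //=.
  rewrite !add0r subrr mulr0 addr0 addrK.
  by rewrite mulrAC divff ?mul1r // gt_eqF // ln_gt0 // ltr1n.
rewrite [leLHS]big_mkcond big_nat_recr //= -big_mkcond /=.
rewrite [X in X / _]big_mkcond big_nat_recr //= -big_mkcond /=.
have := @mertens1_le N.+2 isT.
move: IH; set H := \sum_(_ <= _ < _ | _) _; set A := \sum_(_ <= _ < _ | _) _.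
have a0 : (0 : R) < ln N.+2%:R by rewrite ln_gt0 // ltr1n.
have b0 : (0 : R) < ln N.+3%:R by rewrite ln_gt0 // ltr1n.
set a := ln N.+2%:R in a0 *; set b := ln N.+3%:R in b0 *.
move=> IH MA.
have ab : a <= b by rewrite ler_ln ?posrE ?ltr0n // ler_nat.
(* Here ln (b / a) >= 1 - a / b = a (1/a - 1/b). *)
have step : (a + ln 16) * (a^-1 - b^-1) <= ln b - ln a + ln 16 * (a^-1 - b^-1).
  rewrite mulrDl lerD2r -ln_div ?posrE //.
  apply: le_trans (ln_ge1BV (divr_gt0 b0 a0)).
  by rewrite invf_div mulrBr divff ?gt_eqF.
have MA' : A * (a^-1 - b^-1) <= (a + ln 16) * (a^-1 - b^-1).
  by rewrite ler_wpM2r // subr_ge0 lef_pV2 ?posrE.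
have -> : (A + (if prime N.+3 then b / N.+3%:R else 0)) / b =
   A / b + (if prime N.+3 then N.+3%:R^-1 else 0).
  rewrite mulrDl; congr (_ + _); case: ifP => _; last by rewrite mul0r.
  by rewrite mulrAC divff ?gt_eqF // mul1r.
move: IH (le_trans MA' step); rewrite !mulrBr; set c := if _ then _ else _.
move: H (A / a) (A / b) (ln 16 / ln 2) (ln 16 / a) (ln 16 / b) (ln (ln 2)) c.
by move: (ln a) (ln b) => *; lra.
Qed.

Lemma mertens2_le (N : nat) : (2 <= N)%N ->
  \sum_(1 <= p < N.+1 | prime p) p%:R^-1 <=
  ln (ln N%:R) + (1 - ln (ln 2) + ln 16 / ln 2) :> R.
Proof.
move=> N2; have := mertens2_aux N2.
have : (0 < N)%N by lia.
move=> /mertens1_le.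
have a0 : (0 : R) < ln N%:R by rewrite ln_gt0 // ltr1n.
rewrite -(ler_pM2r (x := (ln N%:R)^-1)) ?invr_gt0 // mulrDl divff ?gt_eqF //.
rewrite mulrBr; lra.
Qed.

Lemma size_primes_le (n : nat) : (0 < n)%N ->
  (size (primes n))%:R * ln 2 <= ln n%:R :> R.
Proof.
move=> n0; rewrite mulr_natl -lnXn ?ltr0n // ler_ln ?posrE ?exprn_gt0 ?ltr0n //.
rewrite -natrX ler_nat.
apply: (@leq_trans (\prod_(p <- primes n) p)%N); last first.
  apply: dvdn_leq => //.
  rewrite (eq_bigr (fun p => p ^ 1)%N) => [|p _]; last by rewrite expn1.
  apply: (@dvdn_prod_primepow _ (fun=> 1%N)); rewrite ?primes_uniq // => p.
    by rewrite mem_primes => /and3P[].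
  by rewrite mem_primes expn1 => /and3P[].
have -> : (2 ^ size (primes n) = \prod_(p <- primes n) 2)%N.
  by rewrite big_const_seq count_predT iter_muln_1.
rewrite big_seq [leqRHS]big_seq; apply: leq_prod => p.
by rewrite mem_primes => /and3P[/prime_gt1].
Qed.

(** The constant of [mertens2_le] plus [(ln 2)^-1], which bounds the contribution of the prime
    divisors above ln n. *)
Definition mertens_const : R := 1 - ln (ln 2) + ln 16 / ln 2 + (ln 2)^-1.

(** Split at N = floor (ln n). Mertens' bound covers the prime divisors up to N; at most ln n / ln 2
    others remain, each contributing at most 1 / ln n. *)
Lemma sum_inv_primes_le (n : nat) : expR 2 <= n%:R :> R ->
  \sum_(p <- primes n) p%:R^-1 <= ln (ln (ln n%:R)) + mertens_const :> R.
Proof.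
move=> n2.
have n0' : (0 : R) < n%:R by apply: lt_le_trans n2; exact: expR_gt0.
have n0 : (0 < n)%N by rewrite -(ltr0n R).
have l2 : 2 <= ln n%:R :> R by rewrite -ler_expR lnK ?posrE.
have l0 : 0 < ln n%:R :> R by lra.
pose N := Num.truncn (ln n%:R : R).
have N2 : (2 <= N)%N by rewrite truncn_ge_nat // ltW.
have /andP[Nl lN] := truncn_itv (ltW l0); rewrite -/N in Nl lN.
rewrite (bigID (fun p => p <= N)%N) /=.
have -> : ln (ln (ln n%:R)) + mertens_const =
  (ln (ln (ln n%:R)) + (1 - ln (ln 2) + ln 16 / ln 2)) + (ln 2)^-1 :> R.
  by rewrite /mertens_const; ring.
apply: lerD.
  apply: (@le_trans _ _ (\sum_(1 <= p < N.+1 | prime p) p%:R^-1)).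
    rewrite -big_filter -[leRHS]big_filter; apply: ler_sum_sub_uniq.
    - by rewrite filter_uniq // primes_uniq.
    - by rewrite filter_uniq // iota_uniq.
    - move=> p; rewrite !mem_filter mem_primes mem_index_iota ltnS.
      by move=> /andP[-> /and3P[pp _ _]]; rewrite pp prime_gt0.
    - by move=> p _; rewrite invr_ge0 ler0n.
  apply: le_trans (mertens2_le N2) _; rewrite lerD2r.
  have lN0 : 0 < ln N%:R :> R by rewrite ln_gt0 // ltr1n.
  have llN : ln N%:R <= ln (ln n%:R) :> R.
    by rewrite ler_ln ?posrE // ltr0n; lia.
  by rewrite ler_ln ?posrE //; exact: lt_le_trans llN.
apply: (@le_trans _ _ (\sum_(p <- primes n | ~~ (p <= N)%N) (ln n%:R)^-1)).
  apply: ler_sum => p; rewrite -ltnNge => Np.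
  rewrite lef_pV2 ?posrE // ?ltr0n; last by lia.
  by apply: le_trans (ltW lN) _; rewrite ler_nat.
apply: (@le_trans _ _ (\sum_(p <- primes n) (ln n%:R)^-1)).
  rewrite [leRHS](bigID (fun p => p <= N)%N) /= lerDr sumr_ge0 // => p _.
  by rewrite invr_ge0 ltW.
have ln2 : (0 : R) < ln 2 by rewrite ln_gt0 // ltr1n.
rewrite big_const_seq count_predT iter_addr_0 -[leLHS]mulr_natl ler_pdivrMr //.
by rewrite mulrC ler_pdivlMr // size_primes_le.
Qed.

(** Telescoping over all integers from 2 on. The summand is the excess of 1/(p - 1) over 1/p and
    dominates 1/p^2. *)
Lemma sum_inv_pred_le n :
  \sum_(p <- primes n) (p%:R * (p%:R - 1))^-1 <= 1 :> R.
Proof.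
apply: (@le_trans _ _ (\sum_(2 <= p < n.+2) (p%:R * (p%:R - 1))^-1)).
  apply: ler_sum_sub_uniq; rewrite ?primes_uniq ?iota_uniq //.
    move=> p; rewrite mem_primes mem_index_iota => /and3P[pp n0 pn].
    by rewrite prime_gt1 //= ltnS leqW // dvdn_leq.
  move=> p; rewrite mem_index_iota => /andP[p2 _].
  by rewrite invr_ge0 mulr_ge0 // subr_ge0 ler1n; lia.
have -> : \sum_(2 <= p < n.+2) (p%:R * (p%:R - 1))^-1 = 1 - n.+1%:R^-1 :> R.
  elim: n => [|n IH]; first by rewrite big_geq // invr1 subrr.
  rewrite big_nat_recr //= IH -[n.+2%:R]natr1.
  have n0 : (0 : R) < n.+1%:R by rewrite ltr0n.
  by field; rewrite !gt_eqF //; lra.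
by rewrite lerBlDr lerDl invr_ge0.
Qed.

(** The ratio of the totient to n is the product of the 1 - 1/p, each at least exp (- 1/(p - 1));
    replacing 1/(p - 1) by 1/p costs at most 1 in the exponent. *)
Lemma totient_ge (n : nat) : (0 < n)%N ->
  n%:R * expR (- (\sum_(p <- primes n) p%:R^-1) - 1) <= (totient n)%:R :> R.
Proof.
move=> n0.
have nE : n%:R = \prod_(p <- primes n) (p ^ logn p n)%:R :> R.
  by rewrite -natr_prod {1}(prod_prime_decomp n0) prime_decompE big_map.
rewrite totientE // natr_prod.
apply: (@le_trans _ _ (n%:R * \prod_(p <- primes n) expR (- (p%:R - 1)^-1))).
  rewrite ler_wpM2l // -expR_sum ler_expR sumrN -opprD lerN2.
  have := sum_inv_pred_le n; rewrite -(lerD2l (\sum_(p <- primes n) p%:R^-1)).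
  apply: le_trans; rewrite -big_split /= big_seq [leRHS]big_seq.
  apply: ler_sum => p; rewrite mem_primes => /and3P[/prime_gt1 p1 _ _].
  rewrite le_eqVlt; apply/orP; left; apply/eqP.
  have : (1 : R) < p%:R by rewrite ltr1n.
  by move=> p1'; field; rewrite !gt_eqF //; lra.
rewrite nE -big_split /= big_seq [leRHS]big_seq; apply: ler_prod => p pn.
have p1 : (1 < p)%N by move: pn; rewrite mem_primes => /and3P[/prime_gt1].
rewrite mulr_ge0 ?expR_ge0 ?ler0n //=.
have lp : (0 < logn p n)%N by rewrite logn_gt0.
rewrite -{1}(prednK lp) expnS !natrM mulrAC ler_wpM2r ?ler0n //.
have p1' : (1 : R) < p%:R by rewrite ltr1n.
rewrite -subn1 natrB; last by lia.
rewrite expRN ler_pdivrMr ?expR_gt0 //.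
have q0 : 0 <= p%:R - 1 :> R by lra.
apply: le_trans (ler_wpM2l q0 (expR_ge1Dx _)).
by rewrite mulrDr mulr1 divff ?subrK // gt_eqF //; lra.
Qed.
End Mertens.

(** * Product-free sets *)

Lemma coprime_modnMl n a u v : coprime n a ->
  (a * u = a * v %[mod n] -> u = v %[mod n])%N.
Proof.
move=> cna; wlog vu : u v / (v <= u)%N.
  by move=> H E; have [/H|/ltnW/H H'] := leqP v u; [exact|exact/esym/H'].
move=> /eqP; rewrite eqn_mod_dvd ?leq_mul2l ?vu ?orbT // -mulnBr Gauss_dvdr //.
by rewrite -eqn_mod_dvd // => /eqP.
Qed.

Section ProductFree.
Variables (n : nat) (n_gt0 : (0 < n)%N) (S : {set 'I_n}).

Definition resid (d : nat) : 'I_n := Ordinal (ltn_pmod d n_gt0).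

Definition units_mod : {set 'I_n} := [set u : 'I_n | coprime n u].

Definition outside (d : nat) : {set 'I_n} :=
  [set u in units_mod | resid (d * u) \notin S].

Lemma card_units_mod : #|units_mod| = totient n.
Proof.
rewrite totient_count_coprime big_mkord -sum1_card big_mkcond /=.
by apply: eq_bigr => u _; rewrite inE; case: coprime.
Qed.

Lemma gcdn_resid d u : (d %| n)%N -> coprime n u -> gcdn (resid (d * u)) n = d.
Proof.
move=> dn cu; rewrite /= gcdn_modl -{1}(divnK dn) (mulnC _ d) -muln_gcdr.
rewrite gcdnC; have /eqP -> : coprime (n %/ d) u; last by rewrite muln1.
by apply: coprime_dvdl cu; apply/dvdnP; exists d; rewrite mulnC divnK.
Qed.

(** [d * u] modulo n determines u modulo n/d, so adding the quotient of u by n/d, which takes d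
    values, determines u. *)
Lemma card_outside_le d : (d %| n)%N ->
  (#|outside d| <= #|[set c in ~: S | gcdn c n == d]| * d)%N.
Proof.
move=> dn; have d0 : (0 < d)%N := dvdn_gt0 n_gt0 dn.
have nd0 : (0 < n %/ d)%N by rewrite divn_gt0 // dvdn_leq.
have pf (u : 'I_n) : (u %/ (n %/ d) < d)%N.
  by rewrite ltn_divLR // mulnC divnK.
pose f (u : 'I_n) : 'I_n * 'I_d := (resid (d * u), Ordinal (pf u)).
have inj_f : injective f.
  have modd a b : (d * a = d * b %[mod n] -> a = b %[mod n %/ d])%N.
    rewrite -{1 2}(divnK dn) (mulnC (n %/ d)%N) -!muln_modr => /eqP.
    by rewrite eqn_pmul2l // => /eqP.
  move=> u v [/modd Em Eq]; apply/val_inj => /=.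
  by rewrite (divn_eq u (n %/ d)) Em Eq -divn_eq.
rewrite -(card_imset _ inj_f) -[d in (_ * d)%N]card_ord -cardsT -cardsX.
apply/subset_leq_card/subsetP => _ /imsetP[u + ->].
rewrite !inE => /andP[cu ->]; rewrite andbT /=.
by have /= -> := gcdn_resid dn cu; rewrite eqxx.
Qed.

(** If d2 u lies in [S], then (d1 u0)(d2 u) = (d1 d2)(u0 u) is a product of two elements of [S],
    hence outside [S]. So multiplication by u0 injects the units not in [outside d2] into
    [outside (d1 * d2)]. *)
Lemma card_outsideM d1 d2 (u0 : 'I_n) : product_free S ->
  u0 \in units_mod -> resid (d1 * u0) \in S ->
  (#|units_mod| <= #|outside d2| + #|outside (d1 * d2)|)%N.
Proof.
move=> pfS u0U d1S.
have u0c : coprime n u0 by rewrite inE in u0U.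
have sub : outside d2 \subset units_mod.
  by apply/subsetP => u; rewrite inE => /andP[].
have <- : (#|outside d2| + #|units_mod :\: outside d2| = #|units_mod|)%N.
  by rewrite -[RHS](cardsID (outside d2)) (setIidPr sub).
rewrite leq_add2l.
have inj_f : injective (fun u : 'I_n => resid (u0 * u)).
  move=> u v [/(coprime_modnMl u0c)].
  by rewrite !modn_small // => /val_inj.
rewrite -(card_imset _ inj_f).
apply/subset_leq_card/subsetP => _ /imsetP[u + ->].
rewrite !inE negb_and negbK => /andP[/orP[/negP nu uU|d2S uU]] //.
apply/andP; split; first by rewrite /= coprime_modr coprimeMr u0c uU.
apply/negP => d3S.
move/forall_inP: pfS => /(_ _ d1S)/forall_inP/(_ _ d2S)/forall_inP/(_ _ d3S).
rewrite /= modnMml modnMmr modn_mod modnMmr => /eqP; apply.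
by congr (_ %% _)%N; ring.
Qed.

End ProductFree.

(** * Counting over bad sets of prime divisors *)

Section Counting.
Variables (R : realType) (n : nat) (n_gt0 : (0 < n)%N) (S : {set 'I_n}).
Hypothesis pfS : product_free S.

Let I := 'I_(size (primes n)).
Let pr (i : I) : nat := nth 0%N (primes n) i.
Definition inv_prime (i : I) : R := (pr i)%:R^-1.
Let dv (D : {set I}) : nat := (\prod_(i in D) pr i)%N.
Let bad (D : {set I}) : bool :=
  (#|units_mod n| <= 2 * #|outside n_gt0 S (dv D)|)%N.

Let pr_prime i : prime (pr i).
Proof. by have := mem_nth 0%N (ltn_ord i); rewrite mem_primes => /and3P[]. Qed.

Let pr_dvd i : (pr i %| n)%N.
Proof. by have := mem_nth 0%N (ltn_ord i); rewrite mem_primes => /and3P[]. Qed.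

Let pr_inj : injective pr.
Proof.
move=> i j /eqP; rewrite nth_uniq ?primes_uniq ?ltn_ord // => /eqP.
exact: val_inj.
Qed.

Let dv_dvd D : (dv D %| n)%N.
Proof.
rewrite /dv -big_enum /= -(big_map pr xpredT id).
rewrite (eq_bigr (fun p => p ^ 1)%N) => [|p _]; last by rewrite expn1.
apply: (@dvdn_prod_primepow _ (fun=> 1%N)).
- by rewrite map_inj_uniq // enum_uniq.
- by move=> p /mapP[i _ ->].
- by move=> p /mapP[i _ ->]; rewrite expn1.
Qed.

Let dv_inj : injective dv.
Proof.
have memD (D : {set I}) i : (i \in D) = (pr i %| dv D)%N.
  rewrite /dv Euclid_dvd_prod // big_has_cond; apply/idP/hasP => [iD|[j _]].
    by exists i; rewrite ?mem_index_enum //= iD dvdnn.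
  by move=> /andP[jD]; rewrite dvdn_prime2 // => /eqP/pr_inj ->.
by move=> D E DE; apply/setP => i; rewrite !memD DE.
Qed.

Let weight_dv D : setweight inv_prime D = (dv D)%:R^-1.
Proof. by rewrite /setweight /dv natr_prod prodfV. Qed.

Let sum_bad (P : pred {set I}) : (forall D, P D -> bad D) ->
  (\sum_(D | P D) setweight inv_prime D) * #|units_mod n|%:R <=
  2 * #|~: S|%:R :> R.
Proof.
move=> Pbad.
(* A residue is counted for at most one [D]: its gcd with n is [dv D], and [dv] is injective. *)
have step : (\sum_(D | P D) #|[set c in ~: S | gcdn c n == dv D]| <= #|~: S|)%N.
  rewrite (eq_bigr (fun D => \sum_(c in ~: S) (gcdn c n == dv D))%N); last first.
    move=> D _; rewrite -sum1_card big_mkcond [RHS]big_mkcond /=.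
    by apply: eq_bigr => c _; rewrite !inE; case: (c \in S); case: eqP.
  rewrite exchange_big /= -sum1_card; apply: leq_sum => c _.
  case: (pickP (fun D => P D && (gcdn c n == dv D))) => [D /andP[PD /eqP cD]|no].
    rewrite (bigD1 D) //= cD eqxx big1 // => E /andP[_ ED].
    by apply/eqP; rewrite eqb0; apply: contra ED => /eqP/dv_inj ->.
  rewrite big1 // => D PD; have := no D; rewrite PD /= => ->; by [].
apply: (@le_trans _ _
  (2 * (\sum_(D | P D) #|[set c in ~: S | gcdn c n == dv D]|)%:R)); last first.
  by rewrite ler_wpM2l // ler_nat.
rewrite natr_sum big_distrl big_distrr /=; apply: ler_sum => D PD.
have d0 : (0 < dv D)%N := dvdn_gt0 n_gt0 (dv_dvd D).
rewrite weight_dv mulrC ler_pdivrMr ?ltr0n // -!natrM ler_nat.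
apply: leq_trans (Pbad _ PD) _.
by rewrite -mulnA leq_mul2l /= card_outside_le.
Qed.

(** The [k.*2]-sets with a halving into two sets that are not bad are bad themselves; the weight of
    the others is controlled by that of the bad [k]-sets. [sum_bad] bounds both bad families by the
    complement of [S]. *)
Lemma elemsym_complement k :
  'C(k.*2, k)%:R * elemsym inv_prime k.*2 * #|units_mod n|%:R <=
  2 * #|~: S|%:R * ('C(k.*2, k)%:R + 2 * elemsym inv_prime k).
Proof.
have y0 i : 0 <= inv_prime i by rewrite invr_ge0 ler0n.
pose split (E : {set I}) :=
  [exists D : {set I}, [&& D \subset E, #|D| == k, ~~ bad D & ~~ bad (E :\: D)]].
have split_bad E : split E -> bad E.
  case/existsP => D /and4P[DE _ bD bE].
  have dvE : dv E = (dv D * dv (E :\: D))%N.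
    by rewrite /dv (big_setID D) (setIidPr DE).
  rewrite /bad -ltnNge in bD; rewrite /bad -ltnNge in bE.
  have : (0 < #|units_mod n :\: outside n_gt0 S (dv D)|)%N.
    rewrite cardsD subn_gt0 (leq_ltn_trans (subset_leq_card (subsetIr _ _))) //.
    by lia.
  case/card_gt0P => u0; rewrite !inE negb_and negbK => /andP[/orP[/negP//|dS] u0U].
  have u0U' : u0 \in units_mod n by rewrite inE.
  have := card_outsideM (dv (E :\: D)) pfS u0U' dS.
  by rewrite /bad dvE; lia.
have H1 := elemsym_split_bad y0 k bad.
set Wb := \sum_(D : {set I} | _ && bad D) _ in H1.
rewrite -/(split _) in H1.
set Wn := (X in _ * X <= _) in H1.
have Wb_le : Wb * #|units_mod n|%:R <= 2 * #|~: S|%:R.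
  by apply: sum_bad => D /andP[].
have Ws_le : (\sum_(E : {set I} | (#|E| == k.*2) && split E)
    setweight inv_prime E) * #|units_mod n|%:R <= 2 * #|~: S|%:R.
  by apply: sum_bad => D /andP[_ /split_bad].
have eE : elemsym inv_prime k.*2 =
   \sum_(E : {set I} | (#|E| == k.*2) && split E) setweight inv_prime E + Wn.
  by rewrite /elemsym (bigID split).
have e0 := elemsym_ge0 y0 k.
have C0 : (0 : R) <= 'C(k.*2, k)%:R by rewrite ler0n.
have U0 : (0 : R) <= #|units_mod n|%:R by rewrite ler0n.
rewrite {}eE; set Ws := (X in X + Wn); rewrite -/Ws in Ws_le.
move: ('C(_, _)%:R) (#|units_mod n|%:R) (2 * #|~: S|%:R) (elemsym _ k) Wb Wn Ws
  H1 Wb_le Ws_le e0 C0 U0 => C U X e wb wn ws H1 H2 H3 e0 C0 U0.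
have H4 := ler_wpM2r U0 H1.
have H5 := ler_wpM2r e0 H2.
have H6 := ler_wpM2l C0 H3.
lra.
Qed.

End Counting.

(** * The complement of a product-free set *)

Section PoissonWindow.
Variable R : realType.
Implicit Types lam s : R.

(** Exponential form of [poisson_ln_ge] with [C0 = 4], whence 16 = 4^2. *)
Lemma poisson_ge lam s (m : nat) : (0 < m)%N -> 0 < lam ->
  lam <= 4 * m%:R -> m%:R <= s <= m%:R + 2 ->
  expR (s + s * (ln lam - ln s)) <=
  16 * expR 1 * Num.sqrt m%:R * (lam ^+ m / m`!%:R).
Proof.
move=> m0 lam0 lamm ms.
have m0' : (0 : R) < m%:R by rewrite ltr0n.
have f0 : (0 : R) < m`!%:R by rewrite ltr0n fact_gt0.
have H : (1 : R) <= 4 by lra.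
have h := poisson_ln_ge m0 lam0 H lamm ms; rewrite -ler_expR in h; apply: le_trans h _.
rewrite -powR12_sqrt ?ler0n // /powR gt_eqF // !expRD expRN lnK ?posrE //.
rewrite !expRM_natl !lnK ?posrE //.
by rewrite le_eqVlt; apply/orP; left; apply/eqP; ring.
Qed.

Lemma expR1_ge2 : 2 <= expR 1 :> R.
Proof. by have := expR_ge1Dx (1 : R); lra. Qed.

(* The ratio k / lam = e / 4 is the one for which the Poisson(lam) masses at k
   and 2k decay at the same exponential rate. *)
Lemma poisson_window lam : 12 <= lam -> exists k : nat,
  [/\ k.*2%:R <= 3 / 2 * lam,
      expR (1 / 2 * expR 1 * ln 2 * lam) <=
        48 * Num.sqrt (2 * lam) * (lam ^+ k / k`!%:R) &
      expR (1 / 2 * expR 1 * ln 2 * lam) <=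
        48 * Num.sqrt (2 * lam) * (lam ^+ k.*2 / k.*2`!%:R)].
Proof.
move=> l12; have l0 : 0 < lam by lra.
have e2 := expR1_ge2; have e3 := expR1_le R.
pose s := expR 1 / 4 * lam; pose k := Num.truncn s.
have s0 : 0 < s by rewrite mulr_gt0 // divr_gt0 ?expR_gt0.
have /andP[ks sk] := truncn_itv (ltW s0); rewrite -/k in ks sk.
have sl : s <= 3 / 4 * lam by have := ler_wpM2r (ltW l0) e3; rewrite /s; lra.
have ls : lam / 2 <= s by have := ler_wpM2r (ltW l0) e2; rewrite /s; lra.
have k0 : (0 < k)%N by rewrite truncn_gt_nat; lra.
have k1 : (1 : R) <= k%:R by rewrite ler1n.
have k2 : k.*2%:R = 2 * k%:R :> R by rewrite -mul2n natrM.
rewrite -natr1 in sk.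
(* With this value, s (1 + ln lam - ln s) and 2s (1 + ln lam - ln (2s)) both equal 2s ln 2 = (e/2)
   lam ln 2. *)
have lns : ln s = 1 - 2 * ln 2 + ln lam.
  rewrite !lnM ?posrE ?divr_gt0 ?expR_gt0 ?invr_gt0 // lnV ?posrE // expRK.
  by rewrite (_ : 4 = 2 ^+ 2) ?lnXn //; ring.
have ln2s : ln (2 * s) = ln 2 + ln s by rewrite lnM ?posrE.
(* 48 absorbs 16 e, as e <= 14/5. *)
have sqrt_le (m : nat) : m%:R <= 2 * lam ->
  16 * expR 1 * Num.sqrt m%:R * (lam ^+ m / m`!%:R) <=
  48 * Num.sqrt (2 * lam) * (lam ^+ m / m`!%:R).
  have P0 : 0 <= lam ^+ m / m`!%:R by rewrite divr_ge0 // exprn_ge0 // ltW.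
  move=> ml; rewrite ler_wpM2r //.
  apply: ler_pM; rewrite ?sqrtr_ge0 ?mulr_ge0 ?expR_ge0 //; first lra.
  by rewrite ler_wsqrtr.
exists k; split.
- by rewrite k2; lra.
- apply: le_trans (sqrt_le k _); last by lra.
  have km : k%:R <= s <= k%:R + 2 by apply/andP; split; lra.
  have lk : lam <= 4 * k%:R by lra.
  apply: le_trans (poisson_ge k0 l0 lk km); rewrite ler_expR lns /s.
  by rewrite le_eqVlt; apply/orP; left; apply/eqP; field.
- apply: le_trans (sqrt_le k.*2 _); last by rewrite k2; lra.
  have km : k.*2%:R <= 2 * s <= k.*2%:R + 2 by rewrite k2; apply/andP; split; lra.
  have lk : lam <= 4 * k.*2%:R by rewrite k2; lra.
  have k20 : (0 < k.*2)%N by rewrite double_gt0.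
  apply: le_trans (poisson_ge k20 l0 lk km); rewrite ler_expR ln2s lns /s.
  by rewrite le_eqVlt; apply/orP; left; apply/eqP; field.
Qed.

End PoissonWindow.

Section Complement.
Variable R : realType.

Definition rate : R := 1 - 1 / 2 * expR 1 * ln 2.

(** This is e ln 2 <= 2, which follows from ln t <= t - 1 at t = 2/e. *)
Lemma rate_ge0 : 0 <= rate.
Proof.
have e0 := expR_gt0 (1 : R).
have : ln (2 / expR 1) <= 2 / expR 1 - 1 :> R.
  have := @le_ln1Dx R (2 / expR 1 - 1); rewrite (addrC 1) subrK; apply.
  by rewrite ltrBrDr addNr divr_gt0.
rewrite ln_div ?posrE // expRK lerD2r => H.
have := ler_wpM2l (ltW e0) H; rewrite mulrCA divff ?gt_eqF // mulr1.
rewrite /rate; lra.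
Qed.

Lemma sum_inv_prime n :
  \sum_i @inv_prime R n i = \sum_(p <- primes n) p%:R^-1.
Proof. by rewrite (big_nth 0%N) big_mkord. Qed.

Lemma sum_inv_prime_sqr n : \sum_i @inv_prime R n i ^+ 2 <= 1 :> R.
Proof.
apply: le_trans (sum_inv_pred_le R n).
rewrite (big_nth 0%N) big_mkord; apply: ler_sum => i _.
rewrite /inv_prime; set p := nth _ _ _.
have : p \in primes n by exact: mem_nth.
rewrite mem_primes => /and3P[/prime_gt1 p1 _ _].
have p1' : (1 : R) < p%:R by rewrite ltr1n.
rewrite exprVn lef_pV2 ?posrE ?mulr_gt0 ?exprn_gt0 //; [|lra..].
by rewrite expr2 ler_pM2l; lra.
Qed.

(** The identity [C * P2 = P1 ^+ 2] turns the counting inequality into E U <= 2 X (1/P2 + 2/P1), and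
    both reciprocals are at most 1/Q. *)
Lemma window_combine (E C e2 e1 U X P1 P2 Q : R) :
  0 <= E -> 0 < Q -> 0 <= U -> 0 <= C -> 0 <= X ->
  C * e2 * U <= 2 * X * (C + 2 * e1) -> E * P2 <= e2 -> e1 <= P1 ->
  C * P2 = P1 ^+ 2 -> Q <= P1 -> Q <= P2 -> E * Q * U <= 6 * X.
Proof.
move=> E0 Q0 U0 C0 X0 H h2 h1 CP q1 q2.
have P1p : 0 < P1 by lra.
have P2p : 0 < P2 by lra.
have Cp : 0 < C.
  by rewrite -(pmulr_lgt0 C P2p) CP exprn_gt0.
have H1 : C * (E * P2) * U <= 2 * X * (C + 2 * P1).
  apply: le_trans (le_trans _ H) _.
    by rewrite ler_wpM2r // ler_wpM2l.
  by rewrite ler_wpM2l ?mulr_ge0 //; lra.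
have H2 : P1 * P2 * (E * U) <= 2 * X * (P1 + 2 * P2).
  rewrite -(ler_pM2l P1p).
  have := ler_wpM2r (ltW P2p) H1.
  have -> : C * (E * P2) * U * P2 = C * P2 * (P2 * E * U) by ring.
  have -> : 2 * X * (C + 2 * P1) * P2 = 2 * X * (C * P2 + 2 * P1 * P2) by ring.
  rewrite CP => h; apply: le_trans (le_trans _ h) _;
    by rewrite le_eqVlt; apply/orP; left; apply/eqP; ring.
have H3 : Q * (P1 + 2 * P2) <= 3 * (P1 * P2).
  have := ler_wpM2l (ltW P1p) q2; have := ler_wpM2r (ltW P2p) q1; lra.
rewrite -(ler_pM2l (mulr_gt0 P1p P2p)).
have H4 := ler_wpM2l (ltW Q0) H2.
have H5 := ler_wpM2l (mulr_ge0 (ler0n R 2) X0) H3.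
lra.
Qed.

Lemma bin_poisson (lam : R) k :
  'C(k.*2, k)%:R * (lam ^+ k.*2 / k.*2`!%:R) = (lam ^+ k / k`!%:R) ^+ 2.
Proof.
have k2 : (k <= k.*2)%N by lia.
rewrite -(bin_fact k2) (_ : k.*2 - k = k)%N; last by lia.
rewrite !natrM -mul2n mulnC exprM; field.
by rewrite !pnatr_eq0 -!lt0n fact_gt0 bin_gt0; lia.
Qed.

Lemma complement_ge : exists2 c : R, 0 < c &
  forall n (S : {set 'I_n}), (0 < n)%N -> product_free S ->
  n%:R * (c * (expR (- (rate * \sum_(p <- primes n) p%:R^-1)) /
     Num.sqrt (\sum_(p <- primes n) p%:R^-1 + 1))) <= #|~: S|%:R :> R.
Proof.
(* 576 = 6 * 96, from [window_combine] and the bound for [Q]. The factor exp (- 13) is below exp (-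
   lam - 1) when lam < 12, and below exp (- 10) otherwise, where [elemsym_ge] costs exp (- 9) and
   [totient_ge] exp (- 1). *)
exists (expR (- 13) / 576).
  by apply: divr_gt0; [exact: expR_gt0 | rewrite ltr0n].
move=> n S n0 pfS; set lam : R := \sum_(p <- primes n) _.
have lam0 : 0 <= lam by apply: sumr_ge0 => p _; rewrite invr_ge0 ler0n.
have y0 i : 0 <= @inv_prime R n i by rewrite invr_ge0 ler0n.
have phi := totient_ge R n0; rewrite -/lam -card_units_mod in phi.
set U : R := #|units_mod n|%:R in phi.
have U0 : 0 <= U by rewrite ler0n.
have n0' : (0 : R) < n%:R by rewrite ltr0n.
have X0 : (0 : R) <= #|~: S|%:R by rewrite ler0n.
have sq0 : 0 < Num.sqrt (lam + 1) by rewrite sqrtr_gt0; lra.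
(* For lam < 12 the counting inequality at k = 0 suffices: it bounds the number of units by 6 times
   the size of the complement. *)
have [l12|l12] := leP 12 lam; last first.
  have := elemsym_complement R n0 pfS 0.
  rewrite elemsym0 bin0 !mul1r mulr1 -/U => H.
  have sq1 : 1 <= Num.sqrt (lam + 1) by rewrite -[leLHS]sqrtr1 ler_wsqrtr //; lra.
  have b1 : expR (- (rate * lam)) / Num.sqrt (lam + 1) <= 1.
    rewrite ler_pdivrMr // mul1r (le_trans _ sq1) // expR_le1 oppr_le0.
    by rewrite mulr_ge0 ?rate_ge0.
  have b2 : expR (- 13) <= expR (- lam - 1) :> R by rewrite ler_expR; lra.
  have b3 := ler_wpM2l (ltW n0') b2.
  have b4 : 0 <= n%:R * expR (- 13) :> R by rewrite mulr_ge0 ?expR_ge0 ?ltW.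
  have b5 := ler_wpM2l b4 b1.
  lra.
have [k [k2 Q1 Q2]] := poisson_window l12.
set Q := expR (1 / 2 * expR 1 * ln 2 * lam) / (48 * Num.sqrt (2 * lam)).
have sq2 : 0 < 48 * Num.sqrt (2 * lam) by rewrite mulr_gt0 // sqrtr_gt0; lra.
have Q0 : 0 < Q by rewrite divr_gt0 ?expR_gt0.
have sl : \sum_i @inv_prime R n i = lam by rewrite sum_inv_prime.
have main : expR (- 9) * Q * U <= 6 * #|~: S|%:R.
  apply: (@window_combine _ 'C(k.*2, k)%:R (elemsym (@inv_prime R n) k.*2)
    (elemsym (@inv_prime R n) k) _ _ (lam ^+ k / k`!%:R) (lam ^+ k.*2 / k.*2`!%:R));
    rewrite ?expR_ge0 ?ler0n //.
  - exact: elemsym_complement.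
  - have := elemsym_ge y0 (sum_inv_prime_sqr n) (k := k.*2).
    by rewrite sl; apply.
  - by have := elemsym_le y0 k; rewrite sl.
  - exact: bin_poisson.
  - by rewrite /Q ler_pdivrMr // [leRHS]mulrC.
  - by rewrite /Q ler_pdivrMr // [leRHS]mulrC.
have sqle : Num.sqrt (2 * lam) <= 2 * Num.sqrt (lam + 1).
  rewrite [X in _ <= X * _](_ : 2 = Num.sqrt 4); last first.
    by rewrite (_ : 4 = 2 ^+ 2) ?sqrtr_sqr ?ger0_norm //; ring.
  by rewrite -sqrtrM // ler_wsqrtr //; lra.
have Qge : expR (1 / 2 * expR 1 * ln 2 * lam) / (96 * Num.sqrt (lam + 1)) <= Q.
  rewrite ler_wpM2l ?expR_ge0 // lef_pV2 ?posrE //; first lra.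
  by rewrite mulr_gt0.
have E9 := expR_ge0 (- 9 : R).
have m1 := ler_wpM2l (mulr_ge0 E9 (ltW Q0)) phi.
set T := expR (1 / 2 * expR 1 * ln 2 * lam) / _ in Qge.
have F0 : 0 <= expR (- 9) * (n%:R * expR (- lam - 1)) :> R.
  by rewrite !mulr_ge0 ?expR_ge0 ?ltW.
have m2 := ler_wpM2l F0 Qge.
have m3 : expR (- 9) * (n%:R * expR (- lam - 1)) * T =
  n%:R * (expR (- 10) / 96 * (expR (- (rate * lam)) / Num.sqrt (lam + 1))).
  rewrite /T invfM.
  have -> : expR (- (rate * lam)) =
      expR (- lam - 1) * expR 1 * expR (1 / 2 * expR 1 * ln 2 * lam).
    by rewrite -!expRD; congr expR; rewrite /rate; ring.
  have -> : expR (- 10) = expR (- 9) / expR 1 :> R.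
    by rewrite -expRN -expRD; congr expR; ring.
  by field; rewrite !gt_eqF ?expR_gt0.
have b1 : expR (- 13) <= expR (- 10) :> R by rewrite ler_expR; lra.
have G0 : 0 <= n%:R * (expR (- (rate * lam)) / Num.sqrt (lam + 1)) :> R.
  by rewrite mulr_ge0 ?divr_ge0 ?expR_ge0 ?ltW.
have b2 := ler_wpM2r G0 b1.
rewrite m3 in m2.
lra.
Qed.

End Complement.

(** * Positivity of the iterated logarithm and conclusion *)

Lemma lnlnln20_gt0 (R : realType) : 0 < ln (ln (ln 20)) :> R.
Proof.
(* By fifth powers, exp 14 <= (14/5)^14 < 20^5. Since e <= 14/5 this gives e^e < 20. *)
have H : expR (14 / 5) < 20 :> R.
  rewrite -(@ltr_pXn2r R 5) ?nnegrE ?expR_ge0 // -expRM_natl.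
  have -> : 5%:R * (14 / 5) = 14%:R * 1 :> R by field.
  rewrite expRM_natl; have := expR1_le R => /(lerXn2r 14).
  rewrite !nnegrE expR_ge0 => /(_ isT) h; apply: le_lt_trans (h _) _; lra.
have l1 : expR 1 < ln 20 :> R.
  rewrite -ltr_expR lnK ?posrE //; apply: le_lt_trans H.
  by rewrite ler_expR expR1_le.
have l2 : 1 < ln (ln 20) :> R.
  by rewrite -ltr_expR lnK // posrE; apply: lt_trans l1; exact: expR_gt0.
exact: ln_gt0.
Qed.

Theorem theorem1p1 (R : realType) :
  exists c : R, 0 < c /\
    forall n : nat, (20 <= n)%N ->
      max_density R n <
        1 - c / (ln (ln n%:R) `^ (1 - 1 / 2 * expR 1 * ln 2)
                 * Num.sqrt (ln (ln (ln n%:R)))).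
Proof.
have L0 := lnlnln20_gt0 R.
(* The added 1 accounts for the 1 in sqrt (lam + 1), so that lam + 1 <= L + K with L = ln ln ln
   n. *)
pose K : R := `|mertens_const R| + 1.
have K1 : 1 <= K by rewrite lerDr.
have [c0 c0_gt0 compl] := complement_ge R.
(* As L >= ln ln ln 20, the sum L + K is at most (1 + K / ln ln ln 20) L; this moves [K] out of the
   square root. *)
pose c1 : R := c0 * (expR (- (rate R * K)) /
  Num.sqrt (1 + K / ln (ln (ln 20)))).
have q0 : 0 < 1 + K / ln (ln (ln 20)).
  by rewrite addr_gt0 // divr_gt0 //; lra.
have c10 : 0 < c1.
  by rewrite mulr_gt0 // divr_gt0 ?expR_gt0 ?sqrtr_gt0.
(* Halving [c1] makes the final inequality strict. *)
exists (c1 / 2); split; first by rewrite divr_gt0.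
move=> n n20; rewrite -/(rate R).
have n0 : (0 < n)%N by lia.
have n0' : (0 : R) < n%:R by rewrite ltr0n.
have n20' : 20 <= n%:R :> R by rewrite ler_nat.
have ln20 : 0 < ln 20 :> R by rewrite ln_gt0 //; lra.
have lln20 : 0 < ln (ln 20) :> R.
  rewrite ltNge; apply/negP => h.
  by have := L0; rewrite ltNge ln_le0 // (le_trans h).
have ll1 : ln 20 <= ln n%:R :> R by rewrite ler_ln ?posrE //.
have ll2 : ln (ln 20) <= ln (ln n%:R) :> R.
  by rewrite ler_ln ?posrE //; exact: lt_le_trans ll1.
have ll3 : ln (ln (ln 20)) <= ln (ln (ln n%:R)) :> R.
  by rewrite ler_ln ?posrE //; exact: lt_le_trans ll2.
have lln0 : 0 < ln (ln n%:R) :> R by exact: lt_le_trans ll2.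
set L := ln (ln (ln n%:R)) in ll3 *.
have Lp : 0 < L by exact: lt_le_trans ll3.
set lam : R := \sum_(p <- primes n) p%:R^-1.
have e2n : expR 2 <= n%:R :> R.
  apply: le_trans n20'; rewrite -[2]mulr1 expRM_natl.
  have e0 := expR_ge0 (1 : R); have := expR1_le R; rewrite expr2; nra.
have lamL : lam + 1 <= L + K.
  have := sum_inv_primes_le e2n; rewrite -/lam -/L /K.
  have := ler_norm (mertens_const R); lra.
have lam0 : 0 <= lam by apply: sumr_ge0 => p _; rewrite invr_ge0 ler0n.
have rate0 := rate_ge0 R.
have D0 : 0 < ln (ln n%:R) `^ rate R * Num.sqrt L.
  by rewrite mulr_gt0 ?powR_gt0 ?sqrtr_gt0.
have key : c1 / (ln (ln n%:R) `^ rate R * Num.sqrt L) <=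
   c0 * (expR (- (rate R * lam)) / Num.sqrt (lam + 1)).
  rewrite /c1 -mulrA ler_wpM2l ?(ltW c0_gt0) //.
  have -> : expR (- (rate R * K)) / Num.sqrt (1 + K / ln (ln (ln 20))) /
     (ln (ln n%:R) `^ rate R * Num.sqrt L) =
     expR (- (rate R * (L + K))) / Num.sqrt ((1 + K / ln (ln (ln 20))) * L).
    have -> : ln (ln n%:R) `^ rate R = expR (rate R * L) by rewrite /powR gt_eqF.
    rewrite (sqrtrM _ (ltW q0)) (mulrDr (rate R) L K) opprD expRD !invfM.
    rewrite -(expRN (rate R * L)).
    by rewrite mulrACA [X in X * _]mulrC.
  apply: ler_pM; rewrite ?expR_ge0 ?invr_ge0 ?sqrtr_ge0 //.
    by rewrite ler_expR lerN2 ler_wpM2l //; lra.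
  rewrite lef_pV2 ?posrE ?sqrtr_gt0 ?mulr_gt0 //; last by lra.
  rewrite ler_wsqrtr // (le_trans lamL) // mulrDl mul1r lerD2l.
  rewrite mulrAC ler_pdivlMr // ler_wpM2l //; lra.
have dens (S : {set 'I_n}) : product_free S ->
  density R S < 1 - c1 / 2 / (ln (ln n%:R) `^ rate R * Num.sqrt L).
  move=> pfS; have := compl n S n0 pfS; rewrite -/lam.
  have := cardsC S; rewrite card_ord => /(congr1 (fun m => m%:R : R)).
  rewrite natrD => cS; rewrite -ler_pdivlMl // => H.
  have dE : density R S = 1 - n%:R^-1 * #|~: S|%:R.
    rewrite /density -cS; field.
    by rewrite cS gt_eqF.
  have c2 : 0 < c1 / (ln (ln n%:R) `^ rate R * Num.sqrt L) by rewrite divr_gt0.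
  rewrite dE mulrAC; lra.
(* The default value 0 of the maximum must also lie below the bound; it is the density of the empty
   set. *)
apply: bigmax_lt => [|S]; last exact: dens.
have p0 : product_free (set0 : {set 'I_n}).
  by apply/forall_inP => a; rewrite inE.
by have := dens _ p0; rewrite /density cards0 mul0r.
Qed.
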